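(* Let $\mathfrak A$ be an $\aleph_0$-categorical, non-contractible structure and let $\mathfrak B$ be a structure. Then the following are equivalent: (1) $\mathfrak B$ is positive existentially interpretable in $\mathfrak A$; (2) there is a continuous monoid homomorphism $f:\mathrm{End}(\mathfrak A)\to\mathrm{End}(\mathfrak B)$ such that $B$ is covered by finitely many orbits under the image $f[\mathrm{End}(\mathfrak A)]$; (3) there is a continuous monoid homomorphism $f:\mathrm{End}(\mathfrak A)\to\mathrm{End}(\mathfrak B)$ such that $B$ is covered by finitely many orbits under $f[\mathrm{Aut}(\mathfrak A)]$.
   Context: All structures are in an at most countable signature without function symbols (relation symbols, possibly constants); $A,B$ denote the universes of $\mathfrak A,\mathfrak B$. A structure is called $\aleph_0$-categorical if it is finite or a countable model of an $\aleph_0$-categorical theory in an at most countable language. An $\aleph_0$-categorical structure is called contractible if it has a constant endomorphism. Definability is without parameters. $\mathrm{Aut}(\mathfrak M)$ is the automorphism group and $\mathrm{End}(\mathfrak M)$ the monoid of endomorphisms (homomorphisms $\mathfrak M\to\mathfrak M$). Maps act from the right: $x^{\sigma}=\sigma(x)$, $x^{\sigma\tau}=\tau(\sigma(x))$. These monoids carry the topology of pointwise convergence, with basic open sets $U_{\bar a,\bar b}=\{\sigma\mid \bar a^\sigma=\bar b\}$ for finite tuples $\bar a,\bar b$. For a set $\Sigma$ of maps $B\to B$, the orbit of $b\in B$ under $\Sigma$ is $\{b^\sigma\mid\sigma\in\Sigma\}$. The basic sets of a structure are its universe, the diagonal (equality relation), the interpretations of the relation symbols, and the (graphs of the) interpretations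 of the constants. An interpretation of $\mathfrak B$ in $\mathfrak A$ is a surjection $i:U\to B$ with $U\subseteq A^n$ for some $n$, such that the inverse images under $i$ (taken componentwise) of all basic sets of $\mathfrak B$ are definable in $\mathfrak A$; it is positive existential if all these inverse images are definable in $\mathfrak A$ by positive existential formulas (formulas built from atomic formulas, including equalities, $\top$ and $\bot$, using $\wedge,\vee,\exists$). $\mathfrak B$ is positive existentially interpretable in $\mathfrak A$ if such a positive existential interpretation exists. *)

(* Defs.v *)
From HB Require Import structures.
From mathcomp Require Import all_boot.
From mathcomp Require Import boolp classical_sets functions cardinality topology.

Set Implicit Arguments.
Unset Strict Implicit.
Unset Printing Implicit Defensive.

Local Open Scope classical_set_scope.

Record signature := Signature {
  rel_sym : countType;
  arity : rel_sym -> nat;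
  const_sym : countType
}.

Record structure (L : signature) := Structure {
  carrier :> Type;
  carrier_inhabited : inhabited carrier;
  rel_interp : forall R : rel_sym L, set ('I_(arity R) -> carrier);
  const_interp : const_sym L -> carrier
}.

Arguments rel_interp {L} s R.
Arguments const_interp {L} s c.

Inductive term (L : signature) (V : Type) :=
  | Var of V
  | Const of const_sym L.

Arguments Var {L V}.
Arguments Const {L V}.

(* Formulas whose free variables belong to V; a quantifier binds the new      *)
(* variable None of option V.                                                 *)
Inductive formula (L : signature) (V : Type) : Type :=
  | Top
  | Bot
  | Eq of term L V & term L V
  | Rel (R : rel_sym L) of ('I_(arity R) -> term L V)
  | Not of formula L V
  | And of formula L V & formula L V
  | Or of formula L V & formula L V
  | Exists of formula L (option V)
  | Forall of formula L (option V).

Definition sentence (L : signature) := formula L void.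

Fixpoint positive_existential (L : signature) (V : Type) (phi : formula L V)
    : bool :=
  match phi with
  | Top | Bot | Eq _ _ | Rel _ _ => true
  | And p q | Or p q => positive_existential p && positive_existential q
  | Exists p => positive_existential p
  | Not _ | Forall _ => false
  end.

Definition eval (L : signature) (M : structure L) (V : Type) (e : V -> M)
    (t : term L V) : M :=
  match t with
  | Var v => e v
  | Const c => const_interp M c
  end.

Fixpoint satisfies (L : signature) (M : structure L) (V : Type)
    (phi : formula L V) : (V -> M) -> Prop :=
  match phi with
  | Top => fun=> True
  | Bot => fun=> False
  | Eq t u => fun e => eval e t = eval e u
  | Rel R t => fun e => rel_interp M R (fun j => eval e (t j))
  | Not p => fun e => ~ satisfies p e
  | And p q => fun e => satisfies p e /\ satisfies q e
  | Or p q => fun e => satisfies p e \/ satisfies q e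
  | Exists p => fun e => exists x : M, satisfies p (fun o => oapp e x o)
  | Forall p => fun e => forall x : M, satisfies p (fun o => oapp e x o)
  end.

Definition models (L : signature) (M : structure L) (T : set (sentence L)) :=
  forall phi, T phi -> satisfies phi (fun v : void => of_void M v).

Definition is_hom (L : signature) (M N : structure L) (h : M -> N) : Prop :=
  (forall (R : rel_sym L) (x : 'I_(arity R) -> M),
     rel_interp M R x -> rel_interp N R (h \o x)) /\
  (forall c : const_sym L, h (const_interp M c) = const_interp N c).

Definition is_iso (L : signature) (M N : structure L) (h : M -> N) : Prop :=
  [/\ bijective h,
      forall (R : rel_sym L) (x : 'I_(arity R) -> M),
        rel_interp M R x <-> rel_interp N R (h \o x) &
      forall c : const_sym L, h (const_interp M c) = const_interp N c].

Definition countably_infinite (T : Type) : Prop :=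
  countable [set: T] /\ infinite_set [set: T].

Definition aleph0_categorical_theory (L : signature) (T : set (sentence L)) :=
  (exists M : structure L, countably_infinite M /\ models M T) /\
  (forall M N : structure L,
     countably_infinite M -> models M T ->
     countably_infinite N -> models N T ->
     exists h : M -> N, is_iso h).

Definition aleph0_categorical (L : signature) (M : structure L) : Prop :=
  finite_set [set: M] \/
  (countably_infinite M /\
   exists T : set (sentence L), aleph0_categorical_theory T /\ models M T).

Record endo (L : signature) (M : structure L) := Endo {
  endo_fun :> M -> M;
  endo_hom : is_hom endo_fun
}.

Definition Aut (L : signature) (M : structure L) : set (endo M) :=
  [set s : endo M | is_iso s].

Arguments Aut {L} M.

Definition contractible (L : signature) (M : structure L) : Prop :=
  exists (s : endo M) (c : M), forall x, s x = c.

Section EndoMonoid.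
Variables (L : signature) (M : structure L).

Lemma endo_ext (s t : endo M) : (forall x, s x = t x) -> s = t.
Proof.
case: s t => [s hs] [t ht] /= /funext st; rewrite st in hs *.
by rewrite (Prop_irrelevance hs ht).
Qed.

HB.instance Definition _ := gen_eqMixin (endo M).
HB.instance Definition _ := gen_choiceMixin (endo M).

Lemma endo_one_hom : is_hom (@id M). Proof. by []. Qed.

(* Maps act from the right: the product s * t applies s first. *)
Lemma endo_mul_hom (s t : endo M) : is_hom (fun x => t (s x)).
Proof.
case: s t => [s [sR sc]] [t [tR tc]]; split=> /= [R x /sR /tR //|c].
by rewrite sc tc.
Qed.

Definition endo_one : endo M := Endo endo_one_hom.
Definition endo_mul (s t : endo M) : endo M := Endo (endo_mul_hom s t).

Lemma endo_mulA : associative endo_mul.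
Proof. by move=> s t u; apply: endo_ext. Qed.
Lemma endo_mul1s : left_id endo_one endo_mul.
Proof. by move=> s; apply: endo_ext. Qed.
Lemma endo_muls1 : right_id endo_one endo_mul.
Proof. by move=> s; apply: endo_ext. Qed.

HB.instance Definition _ :=
  isMonoid.Build (endo M) endo_mulA endo_mul1s endo_muls1.

Definition endo_nbhd (n : nat) (a b : 'I_n -> M) : set (endo M) :=
  [set s : endo M | forall j, s (a j) = b j].

Definition endo_base : set (set (endo M)) :=
  [set O | exists n (a b : 'I_n -> M), O = endo_nbhd a b].

Lemma endo_base_cover : \bigcup_(O in endo_base) O = setT.
Proof.
apply/seteqP; split=> // s _.
case: (carrier_inhabited M) => m.
exists (@endo_nbhd 0 (fun=> m) (fun=> m)); last by case.
by exists 0, (fun=> m), (fun=> m).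
Qed.

Lemma endo_base_join (O P : set (endo M)) (s : endo M) :
  endo_base O -> endo_base P -> O s -> P s ->
  exists Q, [/\ endo_base Q, Q s & Q `<=` O `&` P].
Proof.
move=> [n [a [b ->]]] [p [c [d ->]]] sab scd.
pose cat (u : 'I_n -> M) (v : 'I_p -> M) (j : 'I_(n + p)) : M :=
  match fintype.split j with inl k => u k | inr k => v k end.
exists (endo_nbhd (cat a c) (cat b d)); split.
- by exists (n + p), (cat a c), (cat b d).
- by move=> j; rewrite /cat; case: fintype.split => k; [exact: sab|exact: scd].
- move=> t tQ; split=> k.
  + by have := tQ (unsplit (inl k)); rewrite /cat unsplitK.
  + by have := tQ (unsplit (inr k)); rewrite /cat unsplitK.
Qed.

HB.instance Definition _ := @isBaseTopological.Build (endo M)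
  (set (endo M)) endo_base id endo_base_cover endo_base_join.

End EndoMonoid.

Definition orbit (L : signature) (M : structure L) (S : set (endo M)) (b : M)
    : set M :=
  [set s b | s in S].

Definition finitely_many_orbits (L : signature) (M : structure L)
    (S : set (endo M)) : Prop :=
  exists F : set M, finite_set F /\ \bigcup_(b in F) orbit S b = [set: M].

Inductive basic_set (L : signature) (M : structure L)
    : forall k : nat, set ('I_k -> M) -> Prop :=
  | basic_universe : @basic_set L M 1 setT
  | basic_diagonal : @basic_set L M 2 [set x | x ord0 = x ord_max]
  | basic_rel (R : rel_sym L) : @basic_set L M (arity R) (rel_interp M R)
  | basic_const (c : const_sym L) :
      @basic_set L M 1 [set x | x ord0 = const_interp M c].

Definition pe_definable (L : signature) (M : structure L) (V : Type)
    (S : set (V -> M)) : Prop :=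
  exists phi : formula L V,
    positive_existential phi /\ S = [set e | satisfies phi e].

(* The componentwise inverse image of a subset of B^k under i : U -> B, where *)
(* U is a subset of A^n, as a subset of A^(k * n).                            *)
Definition interp_preimage (A B : Type) (n : nat) (U : set ('I_n -> A))
    (i : ('I_n -> A) -> B) (k : nat) (S : set ('I_k -> B))
    : set ('I_k * 'I_n -> A) :=
  [set x | (forall j, U (fun l => x (j, l))) /\
           S (fun j => i (fun l => x (j, l)))].

(* The values of i outside U are irrelevant. *)
Definition pe_interpretation (LA LB : signature) (A : structure LA)
    (B : structure LB) (n : nat) (U : set ('I_n -> A))
    (i : ('I_n -> A) -> B) : Prop :=
  set_surj U [set: B] i /\
  forall (k : nat) (S : set ('I_k -> B)),
    basic_set S -> pe_definable (interp_preimage U i S).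

Definition pe_interpretable (LA LB : signature) (B : structure LB)
    (A : structure LA) : Prop :=
  exists (n : nat) (U : set ('I_n -> A)) (i : ('I_n -> A) -> B),
    pe_interpretation U i.

(* Main.v *)
Require Import Defs.
From HB Require Import structures.
From mathcomp Require Import all_boot.
From mathcomp Require Import boolp classical_sets functions cardinality topology.

(** An aleph_0-categorical A has finitely many Aut(A)-orbits on each A^n. For
    infinite A: a countable type finitely satisfiable in A is realized in an
    ultrapower, hence in a countable elementary substructure of it, hence in A.
    As A is countable, this forces isolated tuples to be dense, which yields an
    elementary substructure of A all of whose tuples are isolated; it is
    isomorphic to A. So every type is isolated, there are finitely many of them
    in each arity, and back and forth turns equal types into equal orbits.

    It follows that End(A)-invariant relations are positive existentially
    definable, and that End(A) modulo Aut(A) is compact. An interpretation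
    i : U -> B lets End(A) act on B by i(u) |-> i(s u), with finitely many
    orbits under Aut(A). Conversely, let B be covered by the orbits of
    b_1, ..., b_m. By compactness some finite tuple a is such that f(s)(b_j)
    depends only on s(a) and no endomorphism is constant on a. The element
    f(s)(b_j) is then coded by s(a), and j by the position of this non-constant
    tuple among constant ones; all relations involved are End(A)-invariant. *)

Set Implicit Arguments.
Unset Strict Implicit.
Unset Printing Implicit Defensive.

Local Open Scope classical_set_scope.

(** * Formulas *)

Definition term_rename (L : signature) (V W : Type) (g : V -> W)
    (t : term L V) : term L W :=
  match t with Var v => Var (g v) | Const c => Const c end.

Fixpoint rename (L : signature) (V W : Type) (g : V -> W) (phi : formula L V)
    : formula L W :=
  match phi with
  | Top => Top L W
  | Bot => Bot L W
  | Eq t u => Eq (term_rename g t) (term_rename g u)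
  | Rel R t => Rel (fun j => term_rename g (t j))
  | Not p => Not (rename g p)
  | And p q => And (rename g p) (rename g q)
  | Or p q => Or (rename g p) (rename g q)
  | Exists p => Exists (rename (omap g) p)
  | Forall p => Forall (rename (omap g) p)
  end.

Lemma eval_rename (L : signature) (M : structure L) (V W : Type) (g : V -> W)
    (t : term L V) (e : W -> M) :
  Defs.eval e (term_rename g t) = Defs.eval (e \o g) t.
Proof. by case: t. Qed.

Lemma oapp_omap (M V W : Type) (g : V -> W) (e : W -> M) (x : M) :
  oapp e x \o omap g = oapp (e \o g) x.
Proof. by apply/funext; case. Qed.

Lemma satisfies_rename (L : signature) (M : structure L) (V W : Type)
    (g : V -> W) (phi : formula L V) (e : W -> M) :
  satisfies (rename g phi) e = satisfies phi (e \o g).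
Proof.
elim: V / phi W g e => //=.
- by move=> V t u W g e; rewrite !eval_rename.
- by move=> V R t W g e; congr rel_interp; apply/funext=> j; rewrite eval_rename.
- by move=> V p IH W g e; rewrite IH.
- by move=> V p IHp q IHq W g e; rewrite IHp IHq.
- by move=> V p IHp q IHq W g e; rewrite IHp IHq.
- move=> V p IH W g e; congr ex; apply/funext=> x.
  by rewrite IH; congr satisfies; rewrite -oapp_omap.
- move=> V p IH W g e; apply: eq_forall => x.
  by rewrite IH; congr satisfies; rewrite -oapp_omap.
Qed.

Lemma positive_existential_rename (L : signature) (V W : Type) (g : V -> W)
    (phi : formula L V) :
  positive_existential (rename g phi) = positive_existential phi.
Proof.
by elim: V / phi W g => //= V p IHp q IHq W g; rewrite IHp IHq.
Qed.

Lemma satisfies_and (L : signature) (M : structure L) (V : Type)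
    (p q : formula L V) (e : V -> M) :
  satisfies (And p q) e <-> satisfies p e /\ satisfies q e.
Proof. by []. Qed.

Definition big_and (L : signature) (V : Type) (I : finType)
    (F : I -> formula L V) : formula L V :=
  foldr (fun i => And (F i)) (Top L V) (enum I).

Definition big_or (L : signature) (V : Type) (I : finType)
    (F : I -> formula L V) : formula L V :=
  foldr (fun i => Or (F i)) (Bot L V) (enum I).

Lemma satisfies_big_and (L : signature) (M : structure L) (V : Type)
    (I : finType) (F : I -> formula L V) (e : V -> M) :
  satisfies (big_and F) e <-> forall i, satisfies (F i) e.
Proof.
suff H (s : seq I) : satisfies (foldr (fun i => And (F i)) (Top L V) s) e <->
    forall i, i \in s -> satisfies (F i) e.
  by rewrite /big_and H; split=> h i; [apply: h; rewrite mem_enum|move=> _].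
elim: s => [//|i s IH] /=; rewrite IH; split.
  by move=> [hi hs] j; rewrite inE => /orP[/eqP->|/hs].
by move=> h; split=> [|j js]; apply: h; rewrite inE ?eqxx// js orbT.
Qed.

Lemma satisfies_big_or (L : signature) (M : structure L) (V : Type)
    (I : finType) (F : I -> formula L V) (e : V -> M) :
  satisfies (big_or F) e <-> exists i, satisfies (F i) e.
Proof.
suff H (s : seq I) : satisfies (foldr (fun i => Or (F i)) (Bot L V) s) e <->
    exists2 i, i \in s & satisfies (F i) e.
  rewrite /big_or H; split=> [[i _ h]|[i h]]; first by exists i.
  by exists i; rewrite // mem_enum.
elim: s => [|i s IH] /=; first by split=> // -[].
rewrite IH; split=> [[h|[j js h]]|[j]].
- by exists i; rewrite // inE eqxx.
- by exists j; rewrite // inE js orbT.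
- by rewrite inE => /orP[/eqP->|js] h; [left|right; exists j].
Qed.

Lemma positive_existential_big_and (L : signature) (V : Type) (I : finType)
    (F : I -> formula L V) :
  (forall i, positive_existential (F i)) -> positive_existential (big_and F).
Proof. by move=> h; rewrite /big_and; elim: (enum _) => //= i s ->; rewrite h. Qed.

Lemma positive_existential_big_or (L : signature) (V : Type) (I : finType)
    (F : I -> formula L V) :
  (forall i, positive_existential (F i)) -> positive_existential (big_or F).
Proof. by move=> h; rewrite /big_or; elim: (enum _) => //= i s ->; rewrite h. Qed.

(** * Tuples extended by a last entry, and quantification over entries *)

Definition snoc (X : Type) (n : nat) (e : 'I_n -> X) (x : X) : 'I_n.+1 -> X :=
  fun i => oapp e x (unlift ord_max i).

Lemma snoc_max (X : Type) (n : nat) (e : 'I_n -> X) (x : X) :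
  snoc e x ord_max = x.
Proof. by rewrite /snoc unlift_none. Qed.

Lemma snoc_lift (X : Type) (n : nat) (e : 'I_n -> X) (x : X) (i : 'I_n) :
  snoc e x (lift ord_max i) = e i.
Proof. by rewrite /snoc liftK. Qed.

Lemma snoc_comp (X Y : Type) (n : nat) (g : X -> Y) (e : 'I_n -> X) (x : X) :
  g \o snoc e x = snoc (g \o e) (g x).
Proof. by apply/funext=> i; rewrite /snoc /=; case: unlift. Qed.

Lemma ordS_ind (n : nat) (P : 'I_n.+1 -> Prop) :
  P ord_max -> (forall i, P (lift ord_max i)) -> forall i, P i.
Proof. by move=> p0 p1 i; case: (unliftP ord_max i) => [j|] ->. Qed.

Lemma snoc_initial (X : Type) (n : nat) (f : nat -> X) :
  f \o @nat_of_ord n.+1 = snoc (f \o @nat_of_ord n) (f n).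
Proof.
apply/funext; apply: ordS_ind => [|i]; rewrite ?snoc_max ?snoc_lift //=.
by rewrite /bump leqNgt ltn_ord.
Qed.

Lemma snoc_eta (X : Type) (n : nat) (e : 'I_n.+1 -> X) :
  e = snoc (e \o lift ord_max) (e ord_max).
Proof.
by apply/funext; apply: ordS_ind => [|i]; rewrite ?snoc_max ?snoc_lift.
Qed.

Definition exists_last (L : signature) (n : nat) (phi : formula L 'I_n.+1)
    : formula L 'I_n :=
  Exists (rename (unlift ord_max) phi).

Lemma satisfies_exists_last (L : signature) (M : structure L) (n : nat)
    (phi : formula L 'I_n.+1) (e : 'I_n -> M) :
  satisfies (exists_last phi) e <-> exists x, satisfies phi (snoc e x).
Proof. by split=> /= -[x]; rewrite ?satisfies_rename; exists x; rewrite ?satisfies_rename. Qed.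

(** Induction on [k]: the last variable of the block becomes the variable [None] of a single
    quantifier. The formula [psi] is found before the structure, so it serves all structures at
    once. *)
Lemma exists_block (L : signature) (k : nat) (V : Type)
    (phi : formula L ('I_k + V)) :
  exists psi : formula L V, forall (M : structure L) (e : V -> M),
    satisfies psi e <->
    exists u : 'I_k -> M,
      satisfies phi (fun w => match w with inl i => u i | inr v => e v end).
Proof.
elim: k V phi => [|k IH] V phi.
  pose g (w : 'I_0 + V) : V :=
    match w with inl i => False_rect V (notF (ltn_ord i)) | inr v => v end.
  exists (rename g phi) => M e; rewrite satisfies_rename.
  have E (u : 'I_0 -> M) :
      (fun w => match w with inl i => u i | inr v => e v end) = e \o g.
    by apply/funext=> -[[]|].
  split=> [h|[u]]; last by rewrite E.
  by case: (carrier_inhabited M) => m; exists (fun=> m); rewrite E.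
pose g (w : 'I_k.+1 + V) : 'I_k + option V :=
  match w with
  | inl i => if unlift ord_max i is Some j then inl j else inr None
  | inr v => inr (Some v)
  end.
have [psi psiP] := IH _ (rename g phi).
have E (M : structure L) (e : V -> M) (u : 'I_k -> M) (x : M) :
   (fun w => match w with inl i => u i | inr v => oapp e x v end) \o g =
   (fun w => match w with inl i => snoc u x i | inr v => e v end).
  by apply/funext=> -[i|v] //=; rewrite /snoc; case: unlift.
exists (Exists psi) => M e /=; split=> [[x /psiP[u]]|[u]].
  by rewrite satisfies_rename E; exists (snoc u x).
move=> h; exists (u ord_max); apply/psiP; exists (u \o lift ord_max).
by rewrite satisfies_rename E -snoc_eta.
Qed.

(** * Coding and enumerating formulas *)

Definition term_code (L : signature) (V : Type) (g : V -> nat) (t : term L V)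
    : nat + const_sym L :=
  match t with Var v => inl (g v) | Const c => inr c end.

Definition option_code (V : Type) (g : V -> nat) (o : option V) : nat :=
  if o is Some v then (g v).+1 else 0.

Definition atom_code (L : signature) : countType :=
  ((nat + const_sym L) * (nat + const_sym L) +
   rel_sym L * seq (nat + const_sym L))%type.

(** The variable type grows under quantifiers, so the numbering [g] of the free variables is carried
    along; each quantifier shifts it by one and leaves 0 for the bound variable. *)
Fixpoint formula_code (L : signature) (V : Type) (g : V -> nat)
    (phi : formula L V) : GenTree.tree (atom_code L) :=
  match phi with
  | Top => GenTree.Node 0 [::]
  | Bot => GenTree.Node 1 [::]
  | Eq t u => GenTree.Leaf (inl (term_code g t, term_code g u))
  | Rel R t =>
      GenTree.Leaf (inr (R, [seq term_code g (t j) | j <- enum 'I_(arity R)]))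
  | Not p => GenTree.Node 2 [:: formula_code g p]
  | And p q => GenTree.Node 3 [:: formula_code g p; formula_code g q]
  | Or p q => GenTree.Node 4 [:: formula_code g p; formula_code g q]
  | Exists p => GenTree.Node 5 [:: formula_code (option_code g) p]
  | Forall p => GenTree.Node 6 [:: formula_code (option_code g) p]
  end.

Lemma term_code_inj (L : signature) (V : Type) (g : V -> nat) :
  injective g -> injective (@term_code L V g).
Proof. by move=> gI [v|c] [w|d] //= [] => [/gI->|->]. Qed.

Lemma option_code_inj (V : Type) (g : V -> nat) :
  injective g -> injective (option_code g).
Proof. by move=> gI [v|] [w|] //= [] /gI->. Qed.

Lemma formula_code_inj (L : signature) (V : Type) (g : V -> nat) :
  injective g -> injective (@formula_code L V g).
Proof.
move=> gI phi; elim: V / phi g gI.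
- by move=> V g gI [].
- by move=> V g gI [].
- by move=> V t u g gI [] // t' u' [] /(term_code_inj gI)-> /(term_code_inj gI)->.
- move=> V R t g gI [] // R2 t2 /= E; case: E => RR2; case: R2 / RR2 t2 => t2 h.
  congr Rel; apply/funext=> j; apply: (term_code_inj gI).
  by move/eq_in_map: h; apply; rewrite mem_enum.
- by move=> V p IH g gI [] // q [] /(IH _ gI)->.
- by move=> V p IHp q IHq g gI [] // p' q' [] /(IHp _ gI)-> /(IHq _ gI)->.
- by move=> V p IHp q IHq g gI [] // p' q' [] /(IHp _ gI)-> /(IHq _ gI)->.
- by move=> V p IH g gI [] // q [] /(IH _ (option_code_inj gI))->.
- by move=> V p IH g gI [] // q [] /(IH _ (option_code_inj gI))->.
Qed.

(** The counter in [code] gives every formula infinitely many codes, so it recurs beyond any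
    bound. *)
Lemma formula_enumeration (L : signature) :
  exists F : nat -> {n & formula L 'I_n.+1},
    forall phi k, exists2 j, k <= j & F j = phi.
Proof.
pose C := (nat * (GenTree.tree (atom_code L) * nat))%type.
pose code (phi : {n & formula L 'I_n.+1}) k : C :=
  (tag phi, (formula_code (@nat_of_ord _) (tagged phi), k)).
have inj phi psi k l : code phi k = code psi l -> phi = psi.
  case: phi psi => [n phi] [m psi] [] /= nm; case: m / nm psi => psi.
  by move=> /(formula_code_inj (@ord_inj _))->.
pose P j phi := exists k, pickle (code phi k) = j.
have /choice[F FP] j : exists psi, (exists phi, P j phi) -> P j psi.
  case: (pselect (exists phi, P j phi)) => [[phi h]|h].
    by exists phi.
  by exists (existT _ 0 (Top L 'I_1)) => /h.
exists F => phi k.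
have [l lk] : exists l, k <= pickle (code phi l).
  (* Pigeonhole: otherwise [k + 1] distinct codes of [phi] would all lie below [k]. *)
  apply: contrapT => /forallNP h.
  have ltk l : pickle (code phi l) < k by rewrite ltnNge; apply/negP/h.
  pose f (i : 'I_k.+1) : 'I_k := Ordinal (ltk i).
  have fI : injective f.
    by move=> i j [] /(pcan_inj pickleK) [] /ord_inj.
  by have := leq_card f fI; rewrite !card_ord ltnn.
exists (pickle (code phi l)) => //.
have [|l' /(pcan_inj pickleK)/inj //] := FP (pickle (code phi l)).
by exists phi, l.
Qed.

(** Dependent choice that extends a prescribed tuple one entry at a time: [P] is an invariant of the
    initial segments and [T k] the task carried out at stage [k]. *)
Lemma dependent_sequence (X : Type) (P : forall n, ('I_n -> X) -> Prop)
    (T : nat -> forall n, ('I_n -> X) -> X -> Prop) (n0 : nat)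
    (e0 : 'I_n0 -> X) :
  P n0 e0 ->
  (forall k n (e : 'I_n -> X), P n e -> exists x, P n.+1 (snoc e x) /\ T k n e x) ->
  exists f : nat -> X,
    [/\ f \o @nat_of_ord n0 = e0,
        forall k, P (k + n0) (f \o @nat_of_ord (k + n0)) &
        forall k, T k (k + n0) (f \o @nat_of_ord (k + n0)) (f (k + n0))].
Proof.
move=> P0 step.
have /choice[F FP] (w : {k : nat & {n & {e : 'I_n -> X | P n e}}}) :
    exists x, P _ (snoc (sval (projT2 (projT2 w))) x) /\
              T (projT1 w) _ (sval (projT2 (projT2 w))) x.
  by apply: step; exact: svalP.
pose next k n (w : {e : 'I_n -> X | P n e}) : X := F (existT _ k (existT _ n w)).
pose g := fix g k : {e : 'I_(k + n0) -> X | P (k + n0) e} :=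
  match k with
  | 0 => exist _ e0 P0
  | k'.+1 => exist _ (snoc (sval (g k')) (next k' _ (g k')))
      (FP (existT _ k' (existT _ (k' + n0) (g k')))).1
  end.
(* The entry is prescribed for [i < n0]; otherwise it is the one chosen at stage [i - n0]. *)
pose f i := oapp e0 (next (i - n0) _ (g (i - n0))) (insub i : option 'I_n0).
have fg k : f \o @nat_of_ord (k + n0) = sval (g k).
  elim: k => [|k IH]; first by apply/funext=> i; rewrite /= /f valK.
  rewrite [LHS]snoc_initial IH /=; congr snoc.
  by rewrite /f insubF ?addnK // ltnNge leq_addl.
exists f; split=> [|k|k]; first exact: (fg 0).
- by rewrite fg; exact: svalP.
- have -> : f (k + n0) = next k _ (g k) by rewrite /f insubF ?addnK // ltnNge leq_addl.
  by rewrite fg; exact: (FP (existT _ k (existT _ _ (g k)))).2.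
Qed.

Lemma ord_nat_bounded (n : nat) (r : 'I_n -> nat) : exists N, forall i, r i < N.
Proof.
by exists (\max_i r i).+1 => i; rewrite ltnS; exact: (leq_bigmax_cond (F := r) i).
Qed.

Lemma finite_range_bounded (X : Type) (m : nat -> X) :
  finite_set (range m) -> exists N, forall j, exists i : 'I_N, m j = m i.
Proof.
move=> fin.
have /choice[idx idxP] (x : X) : exists k, range m x -> m k = x.
  by case: (pselect (range m x)) => [[k _ <-]|h]; [exists k|exists 0 => /h].
have /finite_seqP[s sE] := finite_image idx fin.
have [N sN] : exists N, forall k, k \in s -> k < N.
  have [N NP] := ord_nat_bounded (fun i : 'I_(size s) => nth 0 s i).
  exists N => k ks; rewrite -(nth_index 0 ks).
  by move: ks; rewrite -index_mem => ks; exact: (NP (Ordinal ks)).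
exists N => j.
have rj : range m (m j) by exists j.
have ks : idx (m j) \in s.
  have : (idx @` range m) (idx (m j)) by exists (m j).
  by rewrite sE.
by exists (Ordinal (sN _ ks)); rewrite //= idxP.
Qed.

(** * Elementary substructures *)

(* The Tarski-Vaught criterion for the range of a sequence: since n is        *)
(* arbitrary, allowing only initial segments as parameters loses nothing.      *)
Definition tarski_vaught (L : signature) (M : structure L) (m : nat -> M) :=
  forall n (phi : formula L 'I_n.+1),
    (exists x, satisfies phi (snoc (m \o @nat_of_ord n) x)) ->
    exists j, satisfies phi (snoc (m \o @nat_of_ord n) (m j)).

Lemma tarski_vaught_const (L : signature) (M : structure L) (m : nat -> M) c :
  tarski_vaught m -> range m (const_interp M c).
Proof.
move=> tv; have [|j /=] := tv 0 (Eq (Var ord_max) (Const c)).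
  by exists (const_interp M c); rewrite /= snoc_max.
by rewrite snoc_max => <-; exists j.
Qed.

(** Were all values among the first [N], an element of [M] outside them would satisfy the formula
    saying that it differs from each of them; the criterion would then produce a further value of
    [m]. *)
Lemma tarski_vaught_infinite (L : signature) (M : structure L) (m : nat -> M) :
  tarski_vaught m -> infinite_set [set: M] -> infinite_set (range m).
Proof.
move=> tv Minf /finite_range_bounded[N mN].
apply: Minf.
suff -> : [set: M] = range (m \o @nat_of_ord N).
  by apply: finite_image; exact: finite_finset.
apply/seteqP; split=> // x _; apply: contrapT => xN.
have [|j] := tv N
  (big_and (fun i : 'I_N => Not (Eq (Var ord_max) (Var (lift ord_max i))))).
  exists x; apply/satisfies_big_and => i /=.
  by rewrite snoc_max snoc_lift => xi; apply: xN; exists i.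
move/satisfies_big_and => h; have [i ji] := mN j.
by apply: (h i); rewrite /= snoc_max snoc_lift.
Qed.

(* Finiteness of V, in a form stable under [option]. *)
Definition nat_bounded (V : Type) := forall r : V -> nat, exists N, forall v, r v < N.

Lemma nat_bounded_option (V : Type) : nat_bounded V -> nat_bounded (option V).
Proof.
move=> Vb r; have [N NP] := Vb (r \o Some).
exists (maxn N (r None).+1) => -[v|]; rewrite leq_max ?leqnn ?orbT //.
by have /= -> := NP v.
Qed.

Lemma tarski_vaught_elementary (L : signature) (M : structure L) (m : nat -> M) :
  tarski_vaught m ->
  exists (N : structure L) (g : N -> M),
    [/\ injective g, range g = range m &
        forall (V : Type) (phi : formula L V) (e : V -> N), nat_bounded V ->
          (satisfies phi e <-> satisfies phi (g \o e))].
Proof.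
move=> tv.
pose C := {x | range m x}.
have C0 : inhabited C by split; exists (m 0); exists 0.
pose N := @Structure L C C0 (fun R x => rel_interp M R (fun j => sval (x j)))
  (fun c => exist _ (const_interp M c) (tarski_vaught_const c tv)).
pose g : N -> M := sval.
have gI : injective g.
  move=> [x hx] [y hy]; rewrite /g /= => xy; case: y / xy hy => hy.
  by rewrite (Prop_irrelevance hx hy).
exists N, g; split=> //.
  apply/seteqP; split=> [x [y _ <-]|x mx]; first exact: (svalP y).
  by exists (exist _ x mx).
have gE V (e : V -> N) t : g (Defs.eval e t) = Defs.eval (g \o e) t by case: t.
have witness V (phi : formula L (option V)) (e : V -> N) : nat_bounded V ->
    (exists x, satisfies phi (fun o => oapp (g \o e) x o)) ->
    exists y, satisfies phi (oapp (g \o e) (g y)).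
  move=> Vb [x phix].
  (* As [V] is bounded, the parameters [e v] all occur in one initial segment of length [K]; after
     renaming, the criterion applies to that segment. *)
  have /choice[r rP] v : exists k, m k = g (e v).
    by case: (svalP (e v)) => k _ km; exists k; rewrite km.
  have [K rK] := Vb r.
  pose h (o : option V) : 'I_K.+1 :=
    if o is Some v then lift ord_max (Ordinal (rK v)) else ord_max.
  have hE y : snoc (m \o @nat_of_ord K) y \o h = oapp (g \o e) y.
    by apply/funext=> -[v|] /=; rewrite ?snoc_max ?snoc_lift //=.
  have [|j] := tv K (rename h phi).
    by exists x; rewrite satisfies_rename hE.
  rewrite satisfies_rename hE => phij.
  have mj : range m (m j) by exists j.
  by exists (exist _ (m j) mj).
have oappE V (e : V -> N) y : g \o oapp e y = oapp (g \o e) (g y).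
  by apply/funext; case.
move=> V phi; elim: V / phi => //=.
- move=> V t u e _; rewrite -!gE; split=> [->//|/gI//].
- move=> V R t e _; suff -> : (fun j => sval (@Defs.eval L N V e (t j))) =
    (fun j => Defs.eval (g \o e) (t j)) by [].
  by apply/funext=> j; rewrite -gE.
- by move=> V p IH e Vb; rewrite IH.
- by move=> V p IHp q IHq e Vb; rewrite IHp // IHq.
- by move=> V p IHp q IHq e Vb; rewrite IHp // IHq.
- move=> V p IH e Vb; split=> [[y]|/(witness _ _ _ Vb)[y]].
    rewrite IH; last exact: nat_bounded_option.
    by rewrite oappE; exists (g y).
  by rewrite -oappE -IH; [exists y|exact: nat_bounded_option].
- move=> V p IH e Vb; split=> h; last first.
    by move=> y; rewrite IH ?oappE; [exact: h|exact: nat_bounded_option].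
  apply: contrapT => /existsNP nh.
  have [y] := witness _ (Not p) e Vb nh.
  apply; have /IH := h y; rewrite oappE; apply; exact: nat_bounded_option.
Qed.

(* Every formula is handled at infinitely many stages, so at one of them its *)
(* parameters have already been chosen.                                     *)
Lemma tarski_vaught_sequence (L : signature) (M : structure L)
    (Q : forall n, ('I_n -> M) -> Prop) (n0 : nat) (e0 : 'I_n0 -> M) :
  Q n0 e0 ->
  (forall n (e : 'I_n -> M) (phi : formula L 'I_n.+1), Q n e ->
     (exists x, satisfies phi (snoc e x)) ->
     exists x, Q n.+1 (snoc e x) /\ satisfies phi (snoc e x)) ->
  exists m : nat -> M,
    [/\ tarski_vaught m, m \o @nat_of_ord n0 = e0 &
        forall k, Q (k + n0) (m \o @nat_of_ord (k + n0))].
Proof.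
move=> Q0 step; have [F FP] := formula_enumeration L.
pose T k n (e : 'I_n -> M) x := forall (le_n : tag (F k) <= n),
  (exists y, satisfies (tagged (F k)) (snoc (e \o widen_ord le_n) y)) ->
  satisfies (tagged (F k)) (snoc (e \o widen_ord le_n) x).
have [|m [m0 mQ mT]] := @dependent_sequence M Q T n0 e0 Q0.
  move=> k n e Qe.
  case: (pselect (exists (le_n : tag (F k) <= n) y,
      satisfies (tagged (F k)) (snoc (e \o widen_ord le_n) y))); last first.
    (* The formula of stage [k] has too many parameters or no solution here: any extension that
       keeps [Q] will do. *)
    move=> no; have [|x [Qx _]] := step n e (Top L _) Qe.
      by case: (carrier_inhabited M) => x; exists x.
    by exists x; split=> // le_n [y hy]; case: no; exists le_n, y.
  move=> [le_n [y hy]].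
  pose h (i : 'I_(tag (F k)).+1) : 'I_n.+1 :=
    oapp (lift ord_max \o widen_ord le_n) ord_max (unlift ord_max i).
  have hE x : snoc e x \o h = snoc (e \o widen_ord le_n) x.
    apply/funext; apply: ordS_ind => [|i]; rewrite /h /=.
      by rewrite unlift_none /= !snoc_max.
    by rewrite liftK /= !snoc_lift.
  have [|x [Qx]] := step n e (rename h (tagged (F k))) Qe.
    by exists y; rewrite satisfies_rename hE.
  rewrite satisfies_rename hE => hx; exists x; split=> // le_n' _.
  by rewrite (bool_irrelevance le_n' le_n).
exists m; split=> // n phi [x hx].
have [k nk kE] := FP (existT _ n phi) n.
have le_n : tag (F k) <= k + n0 by rewrite kE /= (leq_trans nk) ?leq_addr.
have mE : (m \o @nat_of_ord (k + n0)) \o widen_ord le_n = m \o @nat_of_ord (tag (F k)).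
  by apply/funext.
exists (k + n0); have := mT k le_n; rewrite mE.
by rewrite kE /=; apply; exists x.
Qed.

Lemma enumeration_of_inj (X : Type) (c : X -> nat) :
  inhabited X -> injective c -> exists E : nat -> X, forall x, exists k, E k = x.
Proof.
move=> [x0] cI.
have /choice[E EP] k : exists y, (exists x, c x = k) -> c y = k.
  by case: (pselect (exists x, c x = k)) => [[x xk]|h]; [exists x|exists x0 => /h].
by exists E => x; exists (c x); apply: cI; apply: EP; exists x.
Qed.

Lemma countable_enumeration (X : Type) :
  inhabited X -> countable [set: X] ->
  exists E : nat -> X, forall x, exists k, E k = x.
Proof.
move=> X0 /countable_injP[c cI]; apply: (@enumeration_of_inj _ c) => // x y.
by apply: cI; rewrite inE.
Qed.

Lemma tuple_enumeration (X : Type) (n : nat) :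
  inhabited X -> countable [set: X] ->
  exists E : nat -> ('I_n -> X), forall x, exists k, E k = x.
Proof.
move=> X0 /countable_injP[c cI].
apply: (@enumeration_of_inj _ (fun a => pickle [seq c (a i) | i <- enum 'I_n])).
  by case: X0 => x; split.
move=> a b /(pcan_inj pickleK)/eq_in_map ab; apply/funext=> i.
by apply: cI; rewrite ?inE// ab ?mem_enum.
Qed.

Lemma satisfies_iso (L : signature) (M N : structure L) (h : M -> N) (V : Type)
    (phi : formula L V) (e : V -> M) :
  is_iso h -> satisfies phi e <-> satisfies phi (h \o e).
Proof.
move=> [[h' hK h'K] hR hc].
have hE W (w : W -> M) t : h (Defs.eval w t) = Defs.eval (h \o w) t by case: t.
have oappE W (w : W -> M) y : h \o oapp w y = oapp (h \o w) (h y).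
  by apply/funext; case.
elim: V / phi e => //=.
- by move=> V t u e; rewrite -!hE; split=> [->//|/(can_inj hK)].
- move=> V R t e; rewrite hR.
  by suff -> : h \o (fun j => Defs.eval e (t j)) =
    (fun j => Defs.eval (h \o e) (t j)) by []; apply/funext=> j; rewrite -hE.
- by move=> V p IH e; rewrite IH.
- by move=> V p IHp q IHq e; rewrite IHp IHq.
- by move=> V p IHp q IHq e; rewrite IHp IHq.
- move=> V p IH e; split=> [[x /IH]|[x]].
    by rewrite oappE; exists (h x).
  by rewrite -(h'K x) -oappE -IH; exists (h' x).
- move=> V p IH e; split=> H x.
    by rewrite -(h'K x) -oappE -IH.
  by rewrite IH oappE.
Qed.

(** The range of [m] is a countably infinite elementary substructure of [M], hence a model of [T]
    and isomorphic to [A]; [h] is the sequence [m] carried over to [A]. *)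
Lemma categorical_sequence (L : signature) (A M : structure L) (m : nat -> M)
    (T : set (sentence L)) :
  countably_infinite A -> aleph0_categorical_theory T -> models A T ->
  (forall phi : sentence L, satisfies phi (of_void A) -> satisfies phi (of_void M)) ->
  infinite_set [set: M] -> tarski_vaught m ->
  exists h : nat -> A,
    (forall x, exists k, h k = x) /\
    forall n (phi : formula L 'I_n),
      satisfies phi (m \o @nat_of_ord n) <-> satisfies phi (h \o @nat_of_ord n).
Proof.
move=> Ainf [_ cat] AT AM Minf tv.
have [N [g [gI gr gE]]] := tarski_vaught_elementary tv.
have /choice[idx idxP] (y : N) : exists k, m k = g y.
  have : range m (g y) by rewrite -gr; exists y.
  by move=> [k _ <-]; exists k.
have /choice[mN mNP] k : exists y, g y = m k.
  have : range g (m k) by rewrite gr; exists k.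
  by move=> [y _ <-]; exists y.
have Ninf : countably_infinite N.
  split.
    apply/countable_injP; exists idx => x y _ _ xy.
    by apply: gI; rewrite -!idxP xy.
  move=> fin; apply: (tarski_vaught_infinite tv Minf).
  by rewrite -gr; exact: finite_image.
have NT : models N T.
  move=> phi Tphi; apply/gE; first by move=> r; exists 0 => -[].
  suff -> : g \o (fun v : void => of_void N v) = of_void M by exact/AM/AT.
  by apply/funext=> -[].
have [h hI] := cat N A Ninf NT Ainf AT.
have [[h' hK h'K] _ _] := hI.
exists (h \o mN); split=> [x|n phi].
  exists (idx (h' x)); rewrite -[RHS]h'K /=; congr h.
  by apply: gI; rewrite mNP idxP.
have -> : m \o @nat_of_ord n = g \o (mN \o @nat_of_ord n).
  by apply/funext=> i; rewrite /= mNP.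
rewrite -gE; first exact: satisfies_iso.
exact: ord_nat_bounded.
Qed.

(** * Ultrapowers and realization of types *)

Section Ultrapower.
Variables (L : signature) (A : structure L) (U : set_system nat).
Hypothesis ultraU : UltraFilter U.

Definition ultra_eq (x y : nat -> A) := U [set k | x k = y k].

Let filterU : Filter U. Proof. exact: filter_filter. Qed.

Lemma ultra_quotient : exists (Q : Type) (cls : (nat -> A) -> Q) (rep : Q -> nat -> A),
  cancel rep cls /\ forall x y, cls x = cls y <-> ultra_eq x y.
Proof.
have refl x : ultra_eq x x by exact: filterS filterT.
have sym x y : ultra_eq x y -> ultra_eq y x by apply: filterS => k.
have trans x y z : ultra_eq x y -> ultra_eq y z -> ultra_eq x z.
  by apply: filterS2 => k /= -> ->.
pose Q := {C | exists x, C = ultra_eq x}.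
pose cls x : Q := exist _ (ultra_eq x) (ex_intro _ x erefl).
have clsE x y : cls x = cls y <-> ultra_eq x y.
  split=> [[E]|xy]; first by rewrite E.
  have E : ultra_eq x = ultra_eq y.
    apply/funext=> z; apply/propext.
    by split; apply: trans => //; exact: sym.
  exact: eq_exist.
have /choice[rep repP] (q : Q) : exists x, cls x = q.
  case: q => [C [x xC]]; exists x; rewrite /cls; subst C.
  by congr exist; exact: Prop_irrelevance.
by exists Q, cls, rep; split.
Qed.

(* The last clause is the theorem of Los. *)
Lemma ultrapower_exists : exists (M : structure L) (cls : (nat -> A) -> M) (rep : M -> nat -> A),
  [/\ forall x y, cls x = cls y -> ultra_eq x y,
      forall x, ultra_eq (rep (cls x)) x &
      forall (V : Type) (phi : formula L V) (e : V -> M),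
        satisfies phi e <-> U [set k | satisfies phi (fun v => rep (e v) k)]].
Proof.
have [Q [cls [rep [repK clsE]]]] := ultra_quotient.
have Q0 : inhabited Q.
  by case: (carrier_inhabited A) => a; split; exact: (cls (fun=> a)).
pose M := @Structure L Q Q0
  (fun R x => U [set k | rel_interp A R (fun j => rep (x j) k)])
  (fun c => cls (fun=> const_interp A c)).
have repcls x : ultra_eq (rep (cls x)) x by apply/clsE.
have evalE V (e : V -> M) t :
    ultra_eq (rep (Defs.eval e t)) (fun k => Defs.eval (fun v => rep (e v) k) t).
  by case: t => [v|c] /=; [exact: filterS filterT|exact: repcls].
exists M, cls, rep; split=> // [x y /clsE//|].
have oappE V (e : V -> M) (x : nat -> A) y k : rep y k = x k ->
    (fun o => rep (oapp e y o) k) = (fun o => oapp (fun v => rep (e v) k) (x k) o).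
  by move=> xy; apply/funext; case.
move=> V phi; elim: V / phi.
- by move=> V e /=; split=> // _; exact: filterS filterT.
- move=> V e /=; split=> // /filter_ex; by case.
- move=> V t u e; have tE := evalE _ e t; have uE := evalE _ e u.
  have -> : satisfies (Eq t u) e <-> ultra_eq (rep (Defs.eval e t)) (rep (Defs.eval e u)).
    by rewrite -clsE !repK.
  split=> h; apply: filterS3 h tE uE => k /= ; first by move=> -> <- <-.
  by move=> -> <- ->.
- move=> V R t e /=.
  have tE : U [set k | forall j, rep (Defs.eval e (t j)) k =
                                Defs.eval (fun v => rep (e v) k) (t j)].
    by apply: filter_forall => j; exact: evalE.
  split=> h; apply: filterS2 h tE => k /= h /funext E.
    by rewrite -E.
  by rewrite E.
- move=> V p IH e /=; rewrite IH; split.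
    by have [//|] := in_ultra_setVsetC [set k | satisfies p (fun v => rep (e v) k)] ultraU.
  move=> h h'; have hh := @filterI _ U filterU _ _ h h'.
  by have [k []] := filter_ex hh.
- move=> V p IHp q IHq e /=; rewrite IHp IHq; split=> [[]|h].
    by apply: filterS2.
  by split; apply: filterS h => k [].
- move=> V p IHp q IHq e /=; rewrite IHp IHq; split.
    by case; apply: filterS => k; [left|right].
  (* Disjunction needs an ultrafilter: if the set where [p] holds is not large, its complement is,
     and there [q] holds. *)
  have [|np h] := in_ultra_setVsetC [set k | satisfies p (fun v => rep (e v) k)] ultraU.
    by left.
  by right; apply: filterS2 np h => k np [].
- move=> V p IH e /=; split=> [[y /IH]|h].
    by apply: filterS => k; rewrite /= (oappE _ _ (rep y)) // => h; exists (rep y k).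
  (* A witness is chosen in each coordinate that has one; the class of these choices is a witness in
     the ultrapower. *)
  have /choice[x xP] k : exists a, (exists b, satisfies p (fun o => oapp (fun v => rep (e v) k) b o)) ->
      satisfies p (fun o => oapp (fun v => rep (e v) k) a o).
    case: (pselect (exists b, satisfies p (fun o => oapp (fun v => rep (e v) k) b o))) => [[b]|no].
      by exists b.
    by case: (carrier_inhabited A) => a; exists a => /no.
  exists (cls x); apply/IH; apply: filterS2 h (repcls x) => k /xP h xE.
  by rewrite /= (oappE _ _ x).
- move=> V p IH e /=; split=> [h|h y]; last first.
    apply/IH; apply: filterS h => k h.
    by rewrite /= (oappE _ _ (rep y)).
  (* Dually, a counterexample is chosen in each coordinate that has one; where [p] holds at the
     chosen element, it holds at all elements. *)
  have /choice[x xP] k : exists a, (exists b, ~ satisfies p (fun o => oapp (fun v => rep (e v) k) b o)) ->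
      ~ satisfies p (fun o => oapp (fun v => rep (e v) k) a o).
    case: (pselect (exists b, ~ satisfies p (fun o => oapp (fun v => rep (e v) k) b o))) => [[b]|no].
      by exists b.
    by case: (carrier_inhabited A) => a; exists a => /no.
  have /IH := h (cls x); apply: filterS2 (repcls x) => k xE.
  rewrite /= (oappE _ _ x) // => px b; apply: contrapT => nb.
  by apply: (xP k) => //; exists b.
Qed.

End Ultrapower.

Lemma categorical_realizes (L : signature) (A : structure L)
    (T : set (sentence L)) (n : nat) (p : nat -> formula L 'I_n) :
  countably_infinite A -> aleph0_categorical_theory T -> models A T ->
  (forall k, exists a, forall i, i < k -> satisfies (p i) (a : 'I_n -> A)) ->
  exists a : 'I_n -> A, forall i, satisfies (p i) a.
Proof.
move=> Ainf cat AT /choice[a aP].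
(* An ultrafilter refining the cofinite filter makes each [p i], true of [a k] for all [k > i], true
   of the class [b]. *)
have [U [ultraU evU]] := ultraFilterLemma eventually_filter.
have filterU : Filter U by exact: filter_filter.
have [M [cls [rep [clsI repcls los]]]] := ultrapower_exists A ultraU.
pose b (i : 'I_n) : M := cls (fun k => a k i).
have pb i : satisfies (p i) b.
  apply/los.
  have E : U [set k | forall j, rep (b j) k = a k j].
    by apply: filter_forall => j; exact: repcls.
  have ev : U [set k | i < k] by apply: evU; exists i.+1.
  by apply: filterS2 E ev => k /= /funext -> /aP.
(* The classes of constant sequences form a copy of the infinite set [A]. *)
have Minf : infinite_set [set: M].
  have : infinite_set (range (fun x : A => cls (fun=> x))).
    move=> fin; apply: Ainf.2.
    have cI : injective (fun x : A => cls (fun=> x)).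
      by move=> x y /clsI/filter_ex[].
    have := finite_preimage (B := range (fun x : A => cls (fun=> x))) (f := (fun x : A => cls (fun=> x))).
    by rewrite preimage_range; apply=> // x y _ _; exact: cI.
  by apply: sub_infinite_set.
have AM (phi : sentence L) : satisfies phi (of_void A) -> satisfies phi (of_void M).
  move=> h; apply/los; apply: filterS filterT => k _ /=.
  by suff -> : (fun v => rep (of_void M v) k) = of_void A by []; apply/funext=> -[].
have [|m [tv mb _]] := @tarski_vaught_sequence L M (fun _ _ => True) n b I.
  by move=> k e phi _ [x hx]; exists x.
have [h [_ hE]] := categorical_sequence Ainf cat AT AM Minf tv.
by exists (h \o @nat_of_ord n) => i; apply/hE; rewrite mb.
Qed.

(** * The Ryll-Nardzewski theorem *)

Definition same_type (L : signature) (M : structure L) (n : nat) (a b : 'I_n -> M) :=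
  forall phi : formula L 'I_n, satisfies phi a <-> satisfies phi b.

Definition isolates (L : signature) (M : structure L) (n : nat)
    (theta : formula L 'I_n) (a : 'I_n -> M) :=
  satisfies theta a /\ forall b, satisfies theta b -> same_type a b.

Lemma same_type_sym (L : signature) (M : structure L) (n : nat) (a b : 'I_n -> M) :
  same_type a b -> same_type b a.
Proof. by move=> ab phi; split=> /ab. Qed.

Lemma same_type_trans (L : signature) (M : structure L) (n : nat)
    (a b c : 'I_n -> M) :
  same_type a b -> same_type b c -> same_type a c.
Proof. by move=> ab bc phi; rewrite ab. Qed.

(** Isolation condenses the whole type of the extended tuple into one formula, whose existential
    closure passes from [a] to [b]. *)
Lemma same_type_snoc (L : signature) (M : structure L) (n : nat)
    (theta : formula L 'I_n.+1) (a b : 'I_n -> M) (x : M) :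
  isolates theta (snoc a x) -> same_type a b ->
  exists y, same_type (snoc a x) (snoc b y).
Proof.
move=> [tx tP] ab; have /satisfies_exists_last[y ty] : satisfies (exists_last theta) b.
  by apply/ab/satisfies_exists_last; exists x.
by exists y; exact: tP.
Qed.

Section RyllNardzewski.
Variables (L : signature) (A : structure L) (T : set (sentence L)).
Hypotheses (Ainf : countably_infinite A) (cat : aleph0_categorical_theory T)
  (AT : models A T).

(* If no tuple satisfying phi were isolated, one could choose a decreasing    *)
(* sequence of consistent formulas below phi avoiding one tuple after another. *)
Lemma isolated_dense (n : nat) (phi : formula L 'I_n) :
  (exists a : 'I_n -> A, satisfies phi a) ->
  exists (a : 'I_n -> A) (theta : formula L 'I_n), satisfies phi a /\ isolates theta a.
Proof.
move=> phi0; apply: contrapT => none.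
have [E EP] := tuple_enumeration n (carrier_inhabited A) Ainf.1.
pose sat (psi : formula L 'I_n) := exists a : 'I_n -> A, satisfies psi a /\ satisfies phi a.
have /choice[F FP] (w : formula L 'I_n * ('I_n -> A)) : exists psi : formula L 'I_n,
    sat w.1 -> [/\ sat psi, forall a : 'I_n -> A, satisfies psi a -> satisfies w.1 a
                 & ~ satisfies psi w.2].
  case: w => psi c /=.
  case: (pselect (sat psi)) => [[a [psia phia]]|no]; last by exists psi => /no.
  (* The formula [And psi phi] does not isolate [a], so it also holds at a tuple of another type;
     some [chi'] separates the two. *)
  have [b psib nab] : exists2 b : 'I_n -> A, satisfies (And psi phi) b & ~ same_type a b.
    apply: contrapT => h; apply: none; exists a, (And psi phi); split=> //.
    by split=> // b hb; apply: contrapT => nb; apply: h; exists b.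
  have [chi nchi] := (existsNP _).2 nab.
  have [chi' [chia chib]] : exists chi' : formula L 'I_n,
      satisfies chi' a /\ ~ satisfies chi' b.
    case: (pselect (satisfies chi a)) => ca; case: (pselect (satisfies chi b)) => cb.
    - by case: nchi.
    - by exists chi.
    - by exists (Not chi); split=> //= h; apply: h.
    - by case: nchi.
  (* Whichever of [chi'] and its negation fails at [c] is added to [psi]; the tuples [a] and [b]
     show that either choice stays consistent with [phi]. *)
  case: (pselect (satisfies chi' c)) => cc.
    exists (And psi (Not chi')) => _; split=> [|d []//|[]//].
    by exists b; case: psib.
  exists (And psi chi') => _; split=> [|d []//|[]//].
  by exists a.
pose psi := fix psi k := if k is k'.+1 then F (psi k', E k') else Top L 'I_n.
have psi_sat k : sat (psi k).
  elim: k => [|k IH]; first by case: phi0 => a; exists a.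
  by have [] := FP (psi k, E k) IH.
have psiS k (a : 'I_n -> A) : satisfies (psi k.+1) a -> satisfies (psi k) a.
  by have [_ h _] := FP (psi k, E k) (psi_sat k); exact: h.
have psiE k : ~ satisfies (psi k.+1) (E k).
  by have [] := FP (psi k, E k) (psi_sat k).
have psi_mono (a : 'I_n -> A) k j : j <= k -> satisfies (psi k) a -> satisfies (psi j) a.
  elim: k => [|k IH]; first by rewrite leqn0 => /eqP->.
  by rewrite leq_eqVlt ltnS => /predU1P[->//|jk] /psiS; exact: IH.
have [|a aP] := categorical_realizes (p := psi) Ainf cat AT.
  move=> k; have [a [ha _]] := psi_sat k; exists a => i /ltnW ik.
  exact: psi_mono ha.
(* The tuple realizing all [psi k] occurs in the enumeration, yet each tuple was excluded at its own
   stage. *)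
by have [k ka] := EP a; apply: (psiE k); rewrite ka.
Qed.

Lemma isolated_enumeration : exists h : nat -> A,
  (forall x, exists k, h k = x) /\
  forall n, exists theta, isolates theta (h \o @nat_of_ord n).
Proof.
pose Q n (e : 'I_n -> A) := exists theta, isolates theta e.
have [a0 [theta0 [_ iso0]]] : exists (a : 'I_0 -> A) (theta : formula L 'I_0),
    satisfies (Top L _) a /\ isolates theta a.
  by apply: isolated_dense; case: (carrier_inhabited A) => a; exists (fun=> a).
have [||m [tv _ mQ]] := @tarski_vaught_sequence L A Q 0 a0; first by exists theta0.
  move=> n e phi [theta [te tP]] [x phix].
  pose theta' := rename (lift ord_max) theta.
  have tE (b : 'I_n -> A) y : satisfies theta' (snoc b y) <-> satisfies theta b.
    rewrite satisfies_rename.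
    by suff -> : snoc b y \o lift ord_max = b by []; apply/funext=> i; rewrite /= snoc_lift.
  (* Density gives an isolated tuple whose initial part satisfies [theta], hence has the type of
     [e]; its last entry is then transferred to an extension of [e] itself. *)
  have [|b [eta [/satisfies_and[tb phib] eb]]] := @isolated_dense _ (And theta' phi).
    by exists (snoc e x); split=> //; apply/tE.
  move: tb phib eb; rewrite (snoc_eta b) => /tE tb phib iso.
  have eb := tP _ tb.
  have [y ey] := same_type_snoc iso (same_type_sym eb).
  exists y; split; last exact/ey.
  exists eta; split; first by apply/ey; case: iso.
  by move=> c hc; exact: same_type_trans (same_type_sym ey) (iso.2 _ hc).
have [h [hs hE]] := categorical_sequence Ainf cat AT (fun _ => id) Ainf.2 tv.
exists h; split=> // n.
have := mQ n; rewrite addn0 => -[theta [tm tP]].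
(* Both sequences lie in [A], so [theta] also isolates the tuple taken from [h]. *)
have th : satisfies theta (h \o @nat_of_ord n) by apply/hE.
exists theta; split=> // b hb.
exact: same_type_trans (same_type_sym (tP _ th)) (tP _ hb).
Qed.

(** The entries of [a] occur in an isolated initial segment of the enumeration. The formula [theta]
    says that some tuple satisfying [eta] has the given tuple at the corresponding positions [j]. *)
Lemma all_isolated (n : nat) (a : 'I_n -> A) : exists theta, isolates theta a.
Proof.
have [h [hs hI]] := isolated_enumeration.
have /choice[r rP] i : exists k, h k = a i by exact: hs.
have [K rK] := ord_nat_bounded r.
have [eta [eh eP]] := hI K.
pose j i : 'I_K := Ordinal (rK i).
have [theta tP] := exists_block (And (rename inl eta)
  (big_and (fun i : 'I_n => Eq (Var (inr i)) (Var (inl (j i))))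
     : formula L ('I_K + 'I_n))).
exists theta; split.
  apply/tP; exists (h \o @nat_of_ord K); split; first by rewrite satisfies_rename.
  by apply/satisfies_big_and => i /=; rewrite rP.
move=> b /tP[u /satisfies_and[+ /satisfies_big_and/= bu]].
rewrite satisfies_rename => eu phi.
have hu := eP _ eu.
have -> : a = (h \o @nat_of_ord K) \o j by apply/funext=> i; rewrite /= rP.
have -> : b = u \o j by apply/funext=> i; rewrite /= bu.
by have := hu (rename j phi); rewrite !satisfies_rename.
Qed.

(** If no finitely many isolating formulas covered all tuples, a single tuple would satisfy all
    their negations, although it has an isolating formula itself. *)
Lemma finitely_many_types (n : nat) :
  exists (K : nat) (c : 'I_K -> ('I_n -> A)), forall a, exists i, same_type (c i) a.
Proof.
have [E EP] := tuple_enumeration n (carrier_inhabited A) Ainf.1.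
have /choice[theta tP] k := all_isolated (E k).
case: (pselect (forall k, exists a : 'I_n -> A, forall i, i < k -> satisfies (Not (theta i)) a)).
  move=> /(categorical_realizes Ainf cat AT)[a aP].
  by have [k ka] := EP a; case: (aP k); rewrite -ka; case: (tP k).
move=> /existsNP[K KP]; exists K, (fun i => E i) => a; apply: contrapT => /forallNP h.
apply: KP; exists a => i iK ti; apply: (h (Ordinal iK)).
exact: (tP i).2.
Qed.

End RyllNardzewski.

(** * Orbits of tuples under automorphisms; back and forth *)

Definition same_orbit (L : signature) (M : structure L) (n : nat) (a b : 'I_n -> M) :=
  exists s : endo M, is_iso s /\ s \o a = b.

Lemma is_iso_of_homs (L : signature) (M N : structure L) (h : M -> N) (h' : N -> M) :
  is_hom h -> is_hom h' -> cancel h h' -> cancel h' h -> is_iso h.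
Proof.
move=> [hR hc] [h'R _] hK h'K; split=> //; first by exists h'.
move=> R x; split=> [/hR//|/h'R].
by rewrite compA (_ : h' \o h = id) //; apply/funext.
Qed.

Lemma endo_iso_inverse (L : signature) (M : structure L) (s : endo M) :
  is_iso s -> exists t : endo M, [/\ is_iso t, cancel s t & cancel t s].
Proof.
move=> [[t sK tK] sR sc].
have th : is_hom t.
  split=> [R x|c]; last by rewrite -(sc c) sK.
  by rewrite [X in _ -> X]sR compA (_ : s \o t = id) //; apply/funext.
by exists (Endo th); split=> //; apply: is_iso_of_homs tK sK => //; exact: endo_hom.
Qed.

Lemma same_orbit_refl (L : signature) (M : structure L) (n : nat) (a : 'I_n -> M) :
  same_orbit a a.
Proof. by exists (endo_one M); split=> //; split=> //; exists id. Qed.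

Lemma same_orbit_sym (L : signature) (M : structure L) (n : nat) (a b : 'I_n -> M) :
  same_orbit a b -> same_orbit b a.
Proof.
move=> [s [si <-]]; have [t [ti sK _]] := endo_iso_inverse si.
by exists t; split=> //; apply/funext=> i /=; rewrite sK.
Qed.

Lemma same_orbit_trans (L : signature) (M : structure L) (n : nat)
    (a b c : 'I_n -> M) :
  same_orbit a b -> same_orbit b c -> same_orbit a c.
Proof.
move=> [s [si <-]] [t [ti <-]].
have [s' [s'i sK s'K]] := endo_iso_inverse si.
have [t' [t'i tK t'K]] := endo_iso_inverse ti.
exists (endo_mul s t); split=> //.
apply: (@is_iso_of_homs _ _ _ _ (endo_mul t' s')); try exact: endo_hom.
  by move=> x /=; rewrite tK.
by move=> x /=; rewrite s'K.
Qed.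

Lemma same_orbit_type (L : signature) (M : structure L) (n : nat) (a b : 'I_n -> M) :
  same_orbit a b -> same_type a b.
Proof. by move=> [s [si <-]] phi; exact: satisfies_iso. Qed.

Definition pe_type_le (L : signature) (M : structure L) (n : nat) (a b : 'I_n -> M) :=
  forall phi : formula L 'I_n, positive_existential phi ->
    satisfies phi a -> satisfies phi b.

(** Only atomic formulas matter: equalities make [f k |-> g k] well defined, relations and constants
    make it a homomorphism. *)
Lemma hom_of_sequences (L : signature) (M : structure L) (f g : nat -> M) :
  (forall x, exists k, f k = x) ->
  (forall n, exists2 N, n <= N &
     pe_type_le (f \o @nat_of_ord N) (g \o @nat_of_ord N)) ->
  exists s : endo M, forall k, s (f k) = g k.
Proof.
move=> fs fg; have /choice[r rP] := fs.
have gE k l : f k = f l -> g k = g l.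
  move=> kl; have [N lN NP] := fg (maxn k l).+1.
  have kN : k < N by apply: leq_trans lN; rewrite ltnS leq_maxl.
  have lN' : l < N by apply: leq_trans lN; rewrite ltnS leq_maxr.
  exact: (NP (Eq (Var (Ordinal kN)) (Var (Ordinal lN'))) isT kl).
have h : is_hom (g \o r).
  split=> [R x xR|c].
    have [n nP] := ord_nat_bounded (r \o x); have [N lN NP] := fg n.
    have lt j : r (x j) < N by exact: leq_trans (nP j) lN.
    apply: (NP (Rel (fun j => Var (Ordinal (lt j)))) isT).
    by rewrite /= (_ : (fun j => _) = x) //; apply/funext=> j; rewrite rP.
  have [N lN NP] := fg (r (const_interp M c)).+1.
  by apply: (NP (Eq (Var (Ordinal lN)) (Const c)) isT); rewrite /= rP.
by exists (Endo h) => k /=; apply: gE; rewrite rP.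
Qed.

Definition oligomorphic (L : signature) (M : structure L) :=
  forall n, exists (K : nat) (c : 'I_K -> ('I_n -> M)),
    forall a, exists i, same_orbit (c i) a.

(** Back and forth on pairs of tuples of equal type: odd stages put the next element into the
    domain, even stages into the range. *)
Lemma same_type_orbit (L : signature) (M : structure L) :
  countable [set: M] ->
  (forall n (a : 'I_n -> M), exists theta, isolates theta a) ->
  forall n (a b : 'I_n -> M), same_type a b -> same_orbit a b.
Proof.
move=> Mc iso n a b ab.
have [E EP] := countable_enumeration (carrier_inhabited M) Mc.
pose P k (e : 'I_k -> M * M) := same_type (fst \o e) (snd \o e).
pose T k n (e : 'I_n -> M * M) (x : M * M) :=
  (if odd k then x.1 else x.2) = E k./2.
have [||f [f0 fP fT]] := @dependent_sequence _ P T n (fun i => (a i, b i)).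
- exact: ab.
- move=> k l e Pe; rewrite /P /T.
  case: (odd k).
    have [theta tP] := iso _ (snoc (fst \o e) (E k./2)).
    have [y yP] := same_type_snoc tP Pe.
    by exists (E k./2, y); rewrite !snoc_comp.
  have [theta tP] := iso _ (snoc (snd \o e) (E k./2)).
  have [y yP] := same_type_snoc tP (same_type_sym Pe).
  by exists (y, E k./2); rewrite !snoc_comp; split=> //; exact: same_type_sym.
have fs x : exists k, (fst \o f) k = x.
  have [k <-] := EP x; exists (k.*2.+1 + n).
  by have := fT k.*2.+1; rewrite /T /= odd_double /= uphalf_double.
have gs x : exists k, (snd \o f) k = x.
  have [k <-] := EP x; exists (k.*2 + n).
  by have := fT k.*2; rewrite /T /= odd_double /= doubleK.
have [|s sP] := hom_of_sequences (g := snd \o f) fs.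
  move=> k; exists (k + n); first exact: leq_addr.
  by move=> phi _; have /(_ phi)[] := fP k.
have [|t tP] := hom_of_sequences (g := fst \o f) gs.
  move=> k; exists (k + n); first exact: leq_addr.
  by move=> phi _; have /(_ phi)[] := fP k.
exists s; split.
  apply: (is_iso_of_homs (h' := t)); try exact: endo_hom.
    by move=> x; have [k <-] := fs x; rewrite sP tP.
  by move=> x; have [k <-] := gs x; rewrite tP sP.
apply/funext=> i /=.
have fE j : f (nat_of_ord j) = (a j, b j) by rewrite -[RHS](congr1 (@^~ j) f0).
by have := sP i; rewrite /= fE.
Qed.

Lemma aleph0_categorical_countable (L : signature) (A : structure L) :
  aleph0_categorical A -> countable [set: A].
Proof. by move=> [/finite_set_countable|[[]]]. Qed.

Lemma aleph0_categorical_oligomorphic (L : signature) (A : structure L) :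
  aleph0_categorical A -> oligomorphic A.
Proof.
move=> [fin|[Ainf [T [cat AT]]]] n; last first.
  have [K [c cP]] := finitely_many_types Ainf cat AT n.
  exists K, c => a; have [i ci] := cP a; exists i.
  by apply: same_type_orbit ci; [exact: Ainf.1|exact: all_isolated Ainf cat AT].
(* A finite structure has finitely many [n]-tuples, and each represents its own orbit. *)
have [m [g gP]] : exists m (g : 'I_m -> A), forall x, exists i, g i = x.
  have [E EP] := countable_enumeration (carrier_inhabited A) (finite_set_countable fin).
  have [|m mP] := @finite_range_bounded _ E; first exact: sub_finite_set fin.
  exists m, (E \o @nat_of_ord m) => x; have [k <-] := EP x.
  by have [i ->] := mP k; exists i.
exists #|{ffun 'I_n -> 'I_m}|, (fun k => g \o (enum_val k : {ffun 'I_n -> 'I_m})).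
move=> a; have /choice[r rP] i := gP (a i).
exists (enum_rank (finfun r)); rewrite enum_rankK.
suff -> : g \o finfun r = a by exact: same_orbit_refl.
by apply/funext=> i; rewrite /= ffunE.
Qed.

(** * Endomorphisms and positive existential formulas *)

Lemma satisfies_hom (L : signature) (M N : structure L) (h : M -> N) (V : Type)
    (phi : formula L V) (e : V -> M) :
  is_hom h -> positive_existential phi -> satisfies phi e -> satisfies phi (h \o e).
Proof.
move=> [hR hc].
have hE W (w : W -> M) t : h (Defs.eval w t) = Defs.eval (h \o w) t by case: t.
elim: V / phi e => //=.
- by move=> V t u e _; rewrite -!hE => ->.
- move=> V R t e _ /hR.
  by congr rel_interp; apply/funext=> j; rewrite /= hE.
- by move=> V p IHp q IHq e /andP[pp pq] [/(IHp _ pp) ? /(IHq _ pq)].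
- by move=> V p IHp q IHq e /andP[pp pq] [/(IHp _ pp)|/(IHq _ pq)]; [left|right].
- move=> V p IH e pp [x /(IH _ pp) hx]; exists (h x).
  by suff <- : h \o oapp e x = (fun o => oapp (h \o e) (h x) o) by []; apply/funext; case.
Qed.

(** Each orbit meeting [D] gets a representative inside [D], which matters when [D] is not
    invariant, such as the set of extensions of a fixed tuple. *)
Lemma orbit_representatives (L : signature) (A : structure L) (n : nat)
    (D : set ('I_n -> A)) : oligomorphic A ->
  exists (K : nat) (c : 'I_K -> ('I_n -> A)),
    forall a, D a -> exists i, D (c i) /\ same_orbit (c i) a.
Proof.
move=> oli; have [K [c cP]] := oli n.
have /choice[d dP] i : exists d, (exists a, D a /\ same_orbit (c i) a) ->
    D d /\ same_orbit (c i) d.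
  case: (pselect (exists a, D a /\ same_orbit (c i) a)) => [[a h]|h].
    by exists a.
  by exists (c i) => /h.
exists K, d => a Da; have [i ci] := cP a; exists i.
have [|Dd cd] := dP i; first by exists a.
by split=> //; exact: same_orbit_trans (same_orbit_sym cd) ci.
Qed.

(** If every extension of [b] violated some positive existential formula true of the extended [a],
    finitely many such formulas would suffice, one per orbit. The existential closure of their
    conjunction would hold at [a] but not at [b]. *)
Lemma pe_type_le_snoc (L : signature) (A : structure L) (n : nat)
    (a b : 'I_n -> A) (x : A) :
  oligomorphic A -> pe_type_le a b ->
  exists y, pe_type_le (snoc a x) (snoc b y).
Proof.
move=> oli ab; apply: contrapT => none.
have [K [c cP]] := orbit_representatives (fun d => exists y, d = snoc b y) oli.
have /choice[phi phiP] i : exists phi : formula L 'I_n.+1,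
    [/\ positive_existential phi, satisfies phi (snoc a x) &
        (exists y, c i = snoc b y) -> ~ satisfies phi (c i)].
  case: (pselect (exists y, c i = snoc b y)) => [[y ci]|no].
    have : ~ pe_type_le (snoc a x) (snoc b y) by move=> h; apply: none; exists y.
    move=> /existsNP[phi /not_implyP[pp /not_implyP[pa pb]]].
    by exists phi; split=> // _; rewrite ci.
  by exists (Top L _).
have : satisfies (exists_last (big_and phi)) b.
  apply: ab.
    rewrite /= positive_existential_rename.
    by apply: positive_existential_big_and => i; case: (phiP i).
  apply/satisfies_exists_last; exists x; apply/satisfies_big_and => i.
  by case: (phiP i).
move=> /satisfies_exists_last[y /satisfies_big_and yP].
have [|i [ci cy]] := cP (snoc b y); first by exists y.
have [_ _ /(_ ci)] := phiP i; apply.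
by apply/(same_orbit_type cy).
Qed.

(** Only the forth half of back and forth: every element enters the domain, and surjectivity is not
    sought. *)
Lemma endo_of_pe_type_le (L : signature) (A : structure L) (n : nat)
    (a b : 'I_n -> A) :
  countable [set: A] -> oligomorphic A -> pe_type_le a b ->
  exists s : endo A, s \o a = b.
Proof.
move=> Ac oli ab.
have [E EP] := countable_enumeration (carrier_inhabited A) Ac.
pose P k (e : 'I_k -> A * A) := pe_type_le (fst \o e) (snd \o e).
pose T k n (e : 'I_n -> A * A) (x : A * A) := x.1 = E k.
have [||f [f0 fP fT]] := @dependent_sequence _ P T n (fun i => (a i, b i)).
- exact: ab.
- move=> k l e Pe; have [y yP] := pe_type_le_snoc (E k) oli Pe.
  by exists (E k, y); rewrite /P !snoc_comp.
have [||s sP] := @hom_of_sequences _ _ (fst \o f) (snd \o f).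
- by move=> x; have [k <-] := EP x; exists (k + n); exact: fT.
- by move=> k; exists (k + n); [exact: leq_addr|exact: fP].
exists s; apply/funext=> i /=.
have fE j : f (nat_of_ord j) = (a j, b j) by rewrite -[RHS](congr1 (@^~ j) f0).
by have := sP i; rewrite /= fE.
Qed.

(** No endomorphism leads from [S] to its complement, so a positive existential formula separates
    each orbit inside from each orbit outside. Then [S] is the disjunction, over orbits inside, of
    the conjunctions of these formulas over orbits outside. *)
Lemma endo_invariant_pe_definable (L : signature) (A : structure L) (V : finType)
    (S : set (V -> A)) :
  countable [set: A] -> oligomorphic A ->
  (forall (s : endo A) e, S e -> S (s \o e)) -> pe_definable S.
Proof.
move=> Ac oli.
suff H n (S' : set ('I_n -> A)) :
    (forall (s : endo A) e, S' e -> S' (s \o e)) -> pe_definable S'.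
  move=> Sinv; have [|phi [pp phiE]] := H #|V| [set e : 'I_#|V| -> A | S (e \o enum_rank)].
    by move=> s e /= /(Sinv s).
  exists (rename (fun i => enum_val i : V) phi); rewrite positive_existential_rename; split=> //.
  apply/funext=> e; rewrite /= satisfies_rename.
  have /(congr1 (@^~ (e \o (fun i => enum_val i)))) /= <- := phiE.
  by congr S; apply/funext=> v /=; rewrite enum_rankK.
move=> Sinv.
have [K [c cP]] := orbit_representatives S' oli.
have [J [d dP]] := orbit_representatives (~` S') oli.
have /choice[phi phiP] (ij : 'I_K * 'I_J) : exists phi : formula L 'I_n,
    positive_existential phi /\
    (S' (c ij.1) -> ~ S' (d ij.2) -> satisfies phi (c ij.1) /\ ~ satisfies phi (d ij.2)).
  case: ij => i j /=.
  case: (pselect (S' (c i))) => ci; last by exists (Top L _).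
  case: (pselect (S' (d j))) => dj; first by exists (Top L _).
  have : ~ pe_type_le (c i) (d j).
    move=> /(endo_of_pe_type_le Ac oli)[s sE].
    by apply: dj; rewrite -sE; exact: Sinv.
  by move=> /existsNP[phi /not_implyP[pp /not_implyP[pa pb]]]; exists phi.
have /choice[psi psiP] i : exists psi : formula L 'I_n, positive_existential psi /\
    forall a : 'I_n -> A, satisfies psi a <->
      S' (c i) /\ forall j, ~ S' (d j) -> satisfies (phi (i, j)) a.
  case: (pselect (S' (c i))) => ci; last first.
    by exists (Bot L _); split=> // a; split=> // -[].
  have /choice[chi chiP] j : exists chi : formula L 'I_n, positive_existential chi /\
      forall a : 'I_n -> A, satisfies chi a <-> (~ S' (d j) -> satisfies (phi (i, j)) a).
    case: (pselect (S' (d j))) => dj; first by exists (Top L _).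
    exists (phi (i, j)); split; first by case: (phiP (i, j)).
    by move=> a; split=> // h; exact: h.
  exists (big_and chi); split.
    by apply: positive_existential_big_and => j; case: (chiP j).
  move=> a; rewrite satisfies_big_and; split=> [h|[_ h] j]; last exact/(chiP j).2/h.
  by split=> // j; apply/(chiP j).2.
exists (big_or psi); split.
  by apply: positive_existential_big_or => i; case: (psiP i).
have inv a b : same_orbit a b -> S' a -> S' b by move=> [s [_ <-]]; exact: Sinv.
apply/seteqP; split=> a /=; rewrite satisfies_big_or.
  move=> Sa; have [i [ci ca]] := cP a Sa; exists i; apply/(psiP i).2; split=> // j dj.
  by apply/(same_orbit_type ca); case: ((phiP (i, j)).2 ci dj).
move=> [i /(psiP i).2[ci h]]; apply: contrapT => Sa.
have [j [dj da]] := dP a Sa.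
have [_] := (phiP (i, j)).2 ci dj; apply; apply/(same_orbit_type da).
exact: h.
Qed.

(* Modulo automorphisms acting from the right, End(A) is compact. *)
Lemma endo_limit (L : signature) (A : structure L) (E : nat -> A)
    (s : nat -> endo A) :
  oligomorphic A -> (forall x, exists k, E k = x) ->
  exists t : endo A, forall l, exists k (u : endo A),
    [/\ l <= k, is_iso u & forall j, j < l -> u (s k (E j)) = t (E j)].
Proof.
move=> oli EP.
pose g k j := s k (E j).
(* Invariant: infinitely many [s k] map the first [n] elements into the orbit of [h]. *)
pose P n (h : 'I_n -> A) := forall N, exists2 k, N <= k & same_orbit (g k \o @nat_of_ord n) h.
have [e0 P0] : exists e0, P 0 e0.
  case: (carrier_inhabited A) => x; exists (fun=> x) => N; exists N => //.
  by rewrite (_ : g N \o @nat_of_ord 0 = fun=> x); [exact: same_orbit_refl|apply/funext=> -[]].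
have [|h [_ hP _]] := @dependent_sequence _ P (fun _ _ _ _ => True) 0 e0 P0.
  move=> _ n h Ph; apply: contrapT => /forallNP none.
  have [K [c cP]] := orbit_representatives (fun d => exists y, d = snoc h y) oli.
  (* Pigeonhole: if each of the finitely many orbits of extensions of [h] were met only up to some
     stage, a stage beyond all these bounds would be contradictory. *)
  have /choice[N NP] i : exists N, (exists y, c i = snoc h y) ->
      forall k, N <= k -> ~ same_orbit (g k \o @nat_of_ord n.+1) (c i).
    case: (pselect (exists y, c i = snoc h y)) => [[y ci]|no]; last by exists 0.
    have /not_andP[|//] := none y.
    move=> /existsNP[N NP]; exists N => _ k Nk ck; apply: NP; exists k => //.
    by rewrite -ci.
  have [N' N'P] := ord_nat_bounded N.
  have [k Nk [u [ui uh]]] := Ph N'.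
  have [|i [ci cu]] := cP (snoc h (u (g k n))); first by exists (u (g k n)).
  apply: (NP i ci k); first exact/ltnW/(leq_trans (N'P i)).
  apply: same_orbit_trans (same_orbit_sym cu).
  by exists u; split=> //; rewrite snoc_initial snoc_comp uh.
have lim l : exists k (u : endo A),
    [/\ l <= k, is_iso u & forall j, j < l -> u (g k j) = h j].
  have [k lk [u [ui uE]]] := hP l l; exists k, u; split=> // j jl.
  have jl' : j < l + 0 by rewrite addn0.
  exact: (congr1 (@^~ (Ordinal jl')) uE).
have [|t tP] := @hom_of_sequences _ _ E h EP.
  move=> n; exists n => // phi pp.
  have [k [u [_ ui uE]]] := lim n.
  have -> : h \o @nat_of_ord n = endo_mul (s k) u \o (E \o @nat_of_ord n).
    by apply/funext=> j; rewrite /= -uE.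
  by apply: satisfies_hom => //; exact: endo_hom.
by exists t => l; have [k [u [lk ui uE]]] := lim l; exists k, u; split=> // j /uE; rewrite tP.
Qed.

(** Endomorphisms constant on longer and longer initial segments would have a limit modulo
    automorphisms, and it would be a constant endomorphism. *)
Lemma noncontractible_witness (L : signature) (A : structure L) (E : nat -> A) :
  oligomorphic A -> (forall x, exists k, E k = x) -> ~ contractible A ->
  exists l, forall s : endo A, exists i j : 'I_l, s (E i) <> s (E j).
Proof.
move=> oli EP nc; apply: contrapT => /forallNP none.
have /choice[s sP] l : exists s : endo A, forall i j : 'I_l, s (E i) = s (E j).
  have /existsNP[s sP] := none l; exists s => i j; apply: contrapT => ij.
  by apply: sP; exists i, j.
have [t tP] := endo_limit s oli EP.
apply: nc; exists t, (t (E 0)) => x; have [j <-] := EP x.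
have [k [u [jk _ uE]]] := tP j.+1.
rewrite -!uE //; congr (u _).
have lt0 : 0 < k by exact: leq_trans jk.
exact: (sP k (Ordinal jk) (Ordinal lt0)).
Qed.

(** * Pointwise convergence and continuity *)

Section Topology.
Variables (L : signature) (M : structure L).

Lemma endo_nbhsP (s : endo M) (O : set (endo M)) :
  nbhs s O <-> exists n (a : 'I_n -> M), endo_nbhd a (s \o a) `<=` O.
Proof.
rewrite nbhsE; split=> [[P [[D Db <-] [Q DQ Qs]] PO]|[n [a aO]]].
  have [n [a [b QE]]] := Db _ DQ; exists n, a => t ta; apply: PO; exists Q => //.
  move: Qs; rewrite QE => sb j; rewrite ta; exact: sb.
exists (endo_nbhd a (s \o a)) => //; split=> //.
exists [set endo_nbhd a (s \o a)]; last by rewrite bigcup_set1.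
by move=> _ ->; exists n, a, (s \o a).
Qed.

End Topology.

Lemma endo_nbhs_enumeration (L : signature) (M : structure L) (E : nat -> M)
    (s : endo M) (O : set (endo M)) :
  (forall x, exists k, E k = x) -> nbhs s O ->
  exists N, forall t : endo M, (forall j, j < N -> t (E j) = s (E j)) -> O t.
Proof.
move=> EP /endo_nbhsP[n [a aO]].
have /choice[r rP] i := EP (a i); have [N NP] := ord_nat_bounded r.
by exists N => t tE; apply: aO => i /=; rewrite -rP tE.
Qed.

Lemma continuous_endo_pointwise (LA LB : signature) (A : structure LA)
    (B : structure LB) (E : nat -> A) (f : endo A -> endo B) (s : endo A) (b : B) :
  (forall x, exists k, E k = x) -> continuous f ->
  exists N, forall t : endo A, (forall j, j < N -> t (E j) = s (E j)) -> f t b = f s b.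
Proof.
move=> EP fc.
have : nbhs (f s) [set g : endo B | g b = f s b].
  by apply/endo_nbhsP; exists 1, (fun=> b) => g /(_ ord0).
by move=> /(fc s); exact: endo_nbhs_enumeration.
Qed.

(* Continuity only bounds the dependence on s near each s; compactness modulo *)
(* Aut(A) makes the bound uniform.                                            *)
Lemma continuous_endo_uniform (LA LB : signature) (A : structure LA)
    (B : structure LB) (E : nat -> A) (f : endo A -> endo B) (b : B) :
  oligomorphic A -> (forall x, exists k, E k = x) ->
  monoid_morphism f -> continuous f ->
  exists N, forall s t : endo A,
    (forall j, j < N -> s (E j) = t (E j)) -> f s b = f t b.
Proof.
move=> oli EP [f1 fM] fc; apply: contrapT => /forallNP none.
have /choice[st stP] l : exists st : endo A * endo A,
    (forall j, j < l -> st.1 (E j) = st.2 (E j)) /\ f st.1 b <> f st.2 b.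
  have /existsNP[s /existsNP[t /not_implyP[h1 h2]]] := none l.
  by exists (s, t).
have [t tP] := endo_limit (fun k => (st k).1) oli EP.
have [N NP] := continuous_endo_pointwise t b EP fc.
have [k [u [Nk ui uE]]] := tP N.
have [stE nst] := stP k.
have [v [_ uK _]] := endo_iso_inverse ui.
have mulE (x y : endo A) : f (endo_mul x y) b = f y (f x b).
  by rewrite -[endo_mul x y]/(x * y)%g fM.
(* As [f] preserves products and the identity, [f u] is injective, and the disagreement of the pair
   at [b] survives composition with [u]. But both composites agree with the limit [t] on the first
   [N] elements. *)
have fuI : injective (f u).
  apply: (@can_inj _ _ _ (f v)) => y.
  have -> : f v (f u y) = f (u * v)%g y by rewrite fM.
  rewrite (_ : (u * v)%g = 1%g) ?f1 //.
  by apply: endo_ext => x; exact: uK.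
apply: nst; apply: fuI; rewrite -!mulE.
rewrite (NP (endo_mul (st k).1 u)) => [|j jN]; last exact: uE.
rewrite (NP (endo_mul (st k).2 u)) // => j jN /=.
by rewrite -stE ?uE // (leq_trans jN).
Qed.

(** * Interpretations *)

Section InducedEndomorphisms.
Variables (LA LB : signature) (A : structure LA) (B : structure LB).
Variables (n : nat) (U : set ('I_n -> A)) (i : ('I_n -> A) -> B).
Hypothesis iP : pe_interpretation U i.

(** Endomorphisms preserve positive existential formulas. Applied to the universe, the diagonal,
    relations and constants, this makes the induced action well defined and homomorphic. *)
Lemma interp_preimage_endo (s : endo A) (k : nat) (S : set ('I_k -> B))
    (x : 'I_k -> ('I_n -> A)) :
  basic_set S -> (forall j, U (x j)) -> S (i \o x) ->
  (forall j, U (s \o x j)) /\ S (fun j => i (s \o x j)).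
Proof.
move=> /(iP.2)[phi [pp phiE]] Ux Sx.
have : interp_preimage U i S (fun jl => x jl.1 jl.2) by [].
rewrite phiE /= => /(satisfies_hom (endo_hom s) pp).
by have /(congr1 (@^~ (s \o (fun jl => x jl.1 jl.2)))) /= <- := phiE.
Qed.

Lemma interp_domain_endo (s : endo A) (u : 'I_n -> A) : U u -> U (s \o u).
Proof.
move=> Uu; have [//|//|h _] :=
  @interp_preimage_endo s 1 setT (fun=> u) (basic_universe B).
exact: h ord0.
Qed.

Lemma interp_kernel_endo (s : endo A) (u v : 'I_n -> A) :
  U u -> U v -> i u = i v -> i (s \o u) = i (s \o v).
Proof.
move=> Uu Uv uv; pose x (j : 'I_2) := if j == ord0 then u else v.
have [||_] := @interp_preimage_endo s 2 _ x (basic_diagonal B).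
- by move=> j; rewrite /x; case: ifP.
- by [].
- by [].
Qed.

Lemma interp_induced : exists f : endo A -> endo B,
  forall s u, U u -> f s (i u) = i (s \o u).
Proof.
have /choice[r rP] (y : B) : exists u, U u /\ i u = y.
  by have [u Uu <-] := iP.1 y I; exists u.
have ir : i \o r = id by apply/funext=> y; case: (rP y).
have rE (s : endo A) u : U u -> i (s \o r (i u)) = i (s \o u).
  by move=> Uu; apply: interp_kernel_endo => //; case: (rP (i u)).
have hom (s : endo A) : is_hom (fun y => i (s \o r y)).
  split=> [R x xR|c].
    have [||_] := @interp_preimage_endo s _ _ (r \o x) (basic_rel B R) => //.
      by move=> j; case: (rP (x j)).
    by rewrite compA ir.
  have [||_ ->//] :=
    @interp_preimage_endo s _ _ (fun=> r (const_interp B c)) (basic_const B c) => //.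
    by move=> _; case: (rP (const_interp B c)).
  by rewrite /=; case: (rP (const_interp B c)).
by exists (fun s => Endo (hom s)) => s u Uu; exact: rE.
Qed.

Lemma pe_interpretation_morphism : oligomorphic A -> exists f : endo A -> endo B,
  [/\ monoid_morphism f, continuous f & finitely_many_orbits (f @` Aut A)].
Proof.
move=> oli; have [f fE] := interp_induced.
have surj (y : B) : exists2 u, U u & i u = y by have [u] := iP.1 y I; exists u.
exists f; split.
- split=> [|s t]; apply: endo_ext => y; have [u Uu <-] := surj y.
    by rewrite fE.
  have -> : (f s * f t)%g (i u) = f t (f s (i u)) by [].
  rewrite !fE //; exact: interp_domain_endo.
- move=> s O /endo_nbhsP[k [b bO]].
  have /choice[v vP] j : exists u, U u /\ i u = b j.
    by have [u Uu <-] := surj (b j); exists u.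
  apply/endo_nbhsP.
  (* The value of [f s] at [b j] depends only on [s] at the entries of one code [v j], so finitely
     many elements of [A] control a basic neighbourhood. *)
  exists #|{: 'I_k * 'I_n}|, (fun t => v (enum_val t).1 (enum_val t).2).
  move=> t tE; apply: bO => j /=; have [Uv <-] := vP j.
  rewrite !fE //; congr i; apply/funext=> l.
  by have := tE (enum_rank (j, l)); rewrite /= enum_rankK.
- have [K [c cP]] := oli n.
  exists (range (fun k => i (c k))); split.
    by apply: finite_image; exact: finite_finset.
  apply/seteqP; split=> // y _; have [u Uu <-] := surj y.
  have [k cu] := cP u.
  (* The domain [U] is invariant under automorphisms, so the representative of the orbit of [u] lies
     in it. *)
  have Uc : U (c k).
    by have [s [_ <-]] := same_orbit_sym cu; exact: interp_domain_endo.
  have [s [si su]] := cu.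
  exists (i (c k)); first by exists k.
  exists (f s); first by exists s.
  by rewrite fE // su.
Qed.

End InducedEndomorphisms.

(** * From a monoid homomorphism to an interpretation *)

Lemma basic_set_endo (L : signature) (M : structure L) (k : nat)
    (S : set ('I_k -> M)) (s : endo M) (x : 'I_k -> M) :
  basic_set S -> S x -> S (s \o x).
Proof.
have [sR sc] := endo_hom s; move=> Sb.
by case: k S / Sb x => [//|x /= ->//|R x /sR//|c x /= ->]; exact: sc.
Qed.

Lemma finite_set_ord_enumeration (X : Type) (F : set X) :
  finite_set F -> exists m (b : 'I_m -> X), F `<=` range b.
Proof.
elim/Pchoice: X F => X F /finite_seqP[s ->].
exists (size s), (tnth (in_tuple s)) => x /= /(tnthP (in_tuple s))[k ->].
by exists k.
Qed.

(* An element f(s)(b_j) of B is coded by m blocks of l elements: the j-th one  *)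
(* is the image under s of the first l elements of A, the others are constant. *)
(* The j-th block is never constant, so the code determines j.                 *)
Lemma morphism_pe_interpretable (LA LB : signature) (A : structure LA)
    (B : structure LB) (f : endo A -> endo B) :
  countable [set: A] -> oligomorphic A -> ~ contractible A ->
  monoid_morphism f -> continuous f ->
  finitely_many_orbits (f @` [set: endo A]) -> pe_interpretable B A.
Proof.
move=> Ac oli nc fmon fc [F [/finite_set_ord_enumeration[m [b bF]] FB]].
have [E EP] := countable_enumeration (carrier_inhabited A) Ac.
have [l0 l0P] := noncontractible_witness oli EP nc.
have /choice[r rP] j := continuous_endo_uniform (b j) oli EP fmon fc.
have [l1 l1P] := ord_nat_bounded r.
(* Blocks of this length are never constant under an endomorphism and determine every
   [f s (b j)]. *)
pose l := maxn l0 l1.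
have ncl (s : endo A) : exists p q : 'I_l, s (E p) <> s (E q).
  have [p [q pq]] := l0P s.
  by exists (widen_ord (leq_maxl _ _) p), (widen_ord (leq_maxl _ _) q).
have fl j (s t : endo A) : (forall p : 'I_l, s (E p) = t (E p)) -> f s (b j) = f t (b j).
  move=> st; apply: rP => p pr.
  have pl : p < l by apply: leq_trans (leq_maxr _ _); exact: ltn_trans (l1P j).
  exact: (st (Ordinal pl)).
pose I := ('I_m * 'I_l)%type.
pose G (u : I -> A) (y : B) := exists j (s : endo A),
  [/\ forall p, u (j, p) = s (E p), forall j' p q, j' != j -> u (j', p) = u (j', q)
    & y = f s (b j)].
have Gfun u y z : G u y -> G u z -> y = z.
  move=> [j [s [us uc ->]]] [j' [s' [us' uc' ->]]].
  (* If the positions differed, block [j'] would be constant by the first coding and non-constant by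
     the second. *)
  have jj : j' = j.
    apply/eqP; apply: contrapT => /negP jj; have [p [q]] := ncl s'.
    by apply; rewrite -!us'; exact: uc.
  by subst j'; apply: fl => p; rewrite -us -us'.
have GE (t : endo A) u y : G u y -> G (t \o u) (f t y).
  move=> [j [s [us uc ->]]]; exists j, (endo_mul s t); split.
  - by move=> p; rewrite /= us.
  - by move=> j' p q /uc h; rewrite /= (h p q).
  - by rewrite -[endo_mul s t]/(s * t)%g fmon.2.
have Gsurj y : exists u, G u y.
  have : (\bigcup_(x in F) Defs.orbit (f @` [set: endo A]) x) y by rewrite FB.
  move=> [x /bF[j _ <-] [_ [s _ <-] <-]].
  (* The filler [s (E 0)] is arbitrary; the other blocks only have to be constant. *)
  exists (fun jp : I => if jp.1 == j then s (E jp.2) else s (E 0)), j, s; split=> //=.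
    by move=> p; rewrite eqxx.
  by move=> j' p q /negPf ->.
have [i0 iP] : exists i0 : (I -> A) -> B, forall u y, G u y -> i0 u = y.
  have /choice[i0 iP] u : exists y, (exists z, G u z) -> G u y.
    case: (pselect (exists z, G u z)) => [[z uz]|no]; first by exists z.
    by case: (carrier_inhabited B) => z; exists z => /no.
  exists i0 => u y uy; apply: (Gfun u) => //; apply: iP; by exists y.
pose unfold (x : 'I_#|{: I}| -> A) : I -> A := x \o enum_rank.
exists #|{: I}|, [set x | exists y, G (unfold x) y], (i0 \o unfold); split.
  move=> y _; have [u uy] := Gsurj y.
  have uE : unfold (u \o enum_val) = u.
    by apply/funext=> p; rewrite /unfold /= enum_rankK.
  exists (u \o enum_val); last by rewrite /= uE; exact: iP.
  by exists y; rewrite uE.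
(* Invariance suffices: [s] turns codes of [y j] into codes of [f s (y j)], and [f s] preserves
   basic sets. *)
move=> k S Sb; apply: endo_invariant_pe_definable => // s x [xU xS].
have /choice[y yP] := xU.
have yE : y = fun j => i0 (unfold (fun q => x (j, q))).
  by apply/funext=> j; rewrite (iP _ _ (yP j)).
split=> [j|]; first by exists (f s (y j)); exact: (GE s _ _ (yP j)).
suff -> : (fun j => (i0 \o unfold) (fun q => (s \o x) (j, q))) = f s \o y.
  by apply: basic_set_endo => //; rewrite yE.
by apply/funext=> j; apply: iP; exact: (GE s _ _ (yP j)).
Qed.

Theorem theorem11 (LA LB : signature) (A : structure LA) (B : structure LB)
    (catA : aleph0_categorical A) (ncA : ~ contractible A) :
  (pe_interpretable B A <->
   exists f : endo A -> endo B,
     [/\ monoid_morphism f, continuous f &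
         finitely_many_orbits (f @` [set: endo A])]) /\
  (pe_interpretable B A <->
   exists f : endo A -> endo B,
     [/\ monoid_morphism f, continuous f &
         finitely_many_orbits (f @` Aut A)]).
Proof.
have oli := aleph0_categorical_oligomorphic catA.
have Ac := aleph0_categorical_countable catA.
have orbits (f : endo A -> endo B) :
    finitely_many_orbits (f @` Aut A) -> finitely_many_orbits (f @` [set: endo A]).
  move=> [F [Ffin FB]]; exists F; split=> //; apply/seteqP; split=> // y _.
  have : (\bigcup_(x in F) Defs.orbit (f @` Aut A) x) y by rewrite FB.
  move=> [x Fx [_ [s _ <-] <-]]; exists x => //; exists (f s) => //; by exists s.
have int : pe_interpretable B A -> exists f : endo A -> endo B,
    [/\ monoid_morphism f, continuous f & finitely_many_orbits (f @` Aut A)].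
  by move=> [n [U [i iP]]]; exact: pe_interpretation_morphism iP oli.
split; split.
- by move=> /int[f [fm fc /orbits fo]]; exists f.
- by move=> [f [fm fc fo]]; exact: morphism_pe_interpretable fo.
- exact: int.
- by move=> [f [fm fc /orbits fo]]; exact: morphism_pe_interpretable fo.
Qed.
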